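(* Let $\mathbb{P}$ be a tower of height $\delta$ (with filters $\mathcal{F}_X$, $X\in V_\delta$), where $\delta$ is inaccessible. Then there is a stationary set $S\subseteq\mathcal{P}(V_\delta)$ such that for every $X\in V_\delta$, $\mathcal{C}_{V_\delta}\restriction S$ projects to $\mathcal{F}_X$.
   Context: A normal filter on $\mathcal{P}(X)$ is a family $\mathcal{F}\subseteq\mathcal{P}(\mathcal{P}(X))$ that is a filter (closed under finite intersections and supersets within $\mathcal{P}(X)$, $\emptyset\notin\mathcal{F}$), fine ($\{a\subseteq X:x\in a\}\in\mathcal{F}$ for $x\in X$) and normal (if $\mathcal{A}_x\in\mathcal{F}$ for $x\in X$ then $\{a\subseteq X:\forall x\in a\,(a\in\mathcal{A}_x)\}\in\mathcal{F}$). For $Y\subseteq X$, a filter $\mathcal{G}$ on $\mathcal{P}(X)$ projects to $\{\{a\cap Y:a\in\mathcal{A}\}:\mathcal{A}\in\mathcal{G}\}$. A tower of height $\delta$ ($\delta$ a limit ordinal) is a set $\mathbb{P}$ with an assignment $X\mapsto\mathcal{F}_X$ ($X\in V_\delta$) of a normal filter on $\mathcal{P}(X)$ such that $\mathcal{F}_Y$ projects to $\mathcal{F}_X$ for $X\subseteq Y$ in $V_\delta$, and $\mathbb{P}$ is the set of $S\in V_\delta$ such that for some $X\in V_\delta$, $S\subseteq\mathcal{P}(X)$ and $\mathcal{P}(X)\setminus S\notin\mathcal{F}_X$. A set $\mathcal{C}\subseteq\mathcal{P}(Z)$ is club if there is $f:Z^{<\omega}\to Z$ with $\mathcal{C}=\{a\subseteq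 Z:f''a^{<\omega}\subseteq a\}$; $\mathcal{C}_Z$ is the filter generated by clubs; $S$ is stationary if it meets every club; $\mathcal{C}_Z\restriction S=\{\mathcal{B}\subseteq\mathcal{P}(Z):\exists\mathcal{A}\in\mathcal{C}_Z\,(\mathcal{A}\cap S\subseteq\mathcal{B})\}$. *)

(* Defs.v *)
(* Stdlib.  The universe of sets is Aczel's type of well-founded trees modulo
   extensional equality; with classical logic and choice it satisfies ZFC, and
   separation and replacement hold for arbitrary predicates and functions. *)
From Stdlib Require Import List ClassicalEpsilon FunctionalExtensionality
  PropExtensionality ProofIrrelevance.

Inductive tree : Type := node (A : Type) (f : A -> tree).

Fixpoint eqv (x y : tree) : Prop :=
  match x, y with
  | node A f, node B g =>
      (forall a, exists b, eqv (f a) (g b)) /\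
      (forall b, exists a, eqv (f a) (g b))
  end.

Lemma eqv_refl x : eqv x x.
Proof. induction x as [A f IH]; simpl; split; intros a; exists a; apply IH. Qed.

Lemma eqv_sym x : forall y, eqv x y -> eqv y x.
Proof.
induction x as [A f IH]; intros [B g] [H1 H2]; simpl; split.
- intros b; destruct (H2 b) as [a Ha]; exists a; auto.
- intros a; destruct (H1 a) as [b Hb]; exists b; auto.
Qed.

Lemma eqv_trans x : forall y z, eqv x y -> eqv y z -> eqv x z.
Proof.
induction x as [A f IH]; intros [B g] [C h] [H1 H2] [H3 H4]; simpl; split.
- intros a; destruct (H1 a) as [b Hb]; destruct (H3 b) as [c Hc]; eauto.
- intros c; destruct (H4 c) as [b Hb]; destruct (H2 b) as [a Ha]; eauto.
Qed.

Definition V : Type := {c : tree -> Prop | exists t, c = eqv t}.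

Definition cls (t : tree) : V := exist _ (eqv t) (ex_intro _ t eq_refl).

Definition rep (x : V) : tree :=
  proj1_sig (constructive_indefinite_description _ (proj2_sig x)).

Lemma cls_rep x : cls (rep x) = x.
Proof.
unfold rep; destruct (constructive_indefinite_description _ _) as [t Ht]; simpl.
destruct x as [c Hc]; simpl in *; subst c; unfold cls; f_equal.
apply proof_irrelevance.
Qed.

Lemma cls_eq s t : cls s = cls t <-> eqv s t.
Proof.
split; intros H.
- apply (f_equal (@proj1_sig _ _)) in H; simpl in H.
  rewrite H; apply eqv_refl.
- assert (E : eqv s = eqv t).
  { apply functional_extensionality; intros u; apply propositional_extensionality.
    split; intros K; [apply eqv_trans with s|apply eqv_trans with t]; auto.
    now apply eqv_sym. }
  unfold cls; revert H; generalize (ex_intro (fun u => eqv s = eqv u) s eq_refl).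
  rewrite E; intros p _; f_equal; apply proof_irrelevance.
Qed.

Lemma rep_cls t : eqv (rep (cls t)) t.
Proof. apply cls_eq, cls_rep. Qed.

Definition mem_tree (s t : tree) : Prop :=
  match t with node B g => exists b, eqv s (g b) end.

Definition mem (x y : V) : Prop := mem_tree (rep x) (rep y).

Declare Scope zf_scope.
Delimit Scope zf_scope with zf.
Open Scope zf_scope.

Notation "x ∈ y" := (mem x y) (at level 70, no associativity) : zf_scope.
Notation "x ∉ y" := (~ mem x y) (at level 70, no associativity) : zf_scope.

Definition subset (x y : V) : Prop := forall z, z ∈ x -> z ∈ y.
Notation "x ⊆ y" := (subset x y) (at level 70, no associativity) : zf_scope.

Lemma mem_cls x A (f : A -> tree) : x ∈ cls (node A f) <-> exists a, x = cls (f a).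
Proof.
unfold mem; generalize (rep_cls (node A f)).
destruct (rep (cls (node A f))) as [B g]; intros [H1 H2]; simpl; split.
- intros [b Hb]; destruct (H1 b) as [a Ha]; exists a.
  rewrite <- (cls_rep x); apply cls_eq; eauto using eqv_trans.
- intros [a ->]; destruct (H2 a) as [b Hb]; exists b.
  eauto using eqv_trans, rep_cls, eqv_sym.
Qed.

Lemma V_ext x y : (forall z, z ∈ x <-> z ∈ y) -> x = y.
Proof.
rewrite <- (cls_rep x), <- (cls_rep y).
destruct (rep x) as [A f], (rep y) as [B g]; intros H.
apply cls_eq; simpl; split.
- intros a; destruct (proj1 (mem_cls (cls (f a)) B g)) as [b Hb].
  + apply H, mem_cls; eauto.
  + exists b; now apply cls_eq.
- intros b; destruct (proj1 (mem_cls (cls (g b)) A f)) as [a Ha].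
  + apply H, mem_cls; eauto.
  + exists a; apply cls_eq; now symmetry.
Qed.

Lemma V_ind (Q : V -> Prop) : (forall x, (forall y, y ∈ x -> Q y) -> Q x) -> forall x, Q x.
Proof.
intros H x; rewrite <- (cls_rep x); induction (rep x) as [A f IH].
apply H; intros y Hy; apply mem_cls in Hy; destruct Hy as [a ->]; apply IH.
Qed.

(* The set of all values of a function on a small type. *)
Definition range {A} (f : A -> V) : V := cls (node A (fun a => rep (f a))).

Lemma mem_range x A (f : A -> V) : x ∈ range f <-> exists a, x = f a.
Proof.
unfold range; rewrite mem_cls; split; intros [a ->]; exists a;
  [|symmetry]; apply cls_rep.
Qed.

(* Every set is the range of its own small type of elements. *)
Definition index (t : tree) := match t with node A _ => A end.
Definition branch (t : tree) : index t -> tree :=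
  match t with node A f => f end.
Definition El (x : V) := index (rep x).
Definition elt {x : V} (i : El x) : V := cls (branch (rep x) i).

Lemma mem_El x y : x ∈ y <-> exists i : El y, x = elt i.
Proof.
unfold El, elt; rewrite <- (cls_rep y) at 1.
destruct (rep y) as [A f]; apply mem_cls.
Qed.

Definition sep (Q : V -> Prop) (x : V) : V :=
  range (fun i : {i : El x | Q (elt i)} => elt (proj1_sig i)).

Lemma mem_sep z Q x : z ∈ sep Q x <-> z ∈ x /\ Q z.
Proof.
unfold sep; rewrite mem_range, mem_El; split.
- intros [[i Hi] ->]; simpl; eauto.
- intros [[i ->] Hi]; now exists (exist _ i Hi).
Qed.

Definition image (f : V -> V) (x : V) : V := range (fun i : El x => f (elt i)).

Lemma mem_image z f x : z ∈ image f x <-> exists y, y ∈ x /\ z = f y.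
Proof.
unfold image; rewrite mem_range; split.
- intros [i ->]; exists (elt i); split; auto; apply mem_El; eauto.
- intros [y [Hy ->]]; apply mem_El in Hy; destruct Hy as [i ->]; eauto.
Qed.

Definition pow (x : V) : V :=
  range (fun Q : El x -> Prop => range (fun i : {i : El x | Q i} => elt (proj1_sig i))).

Lemma mem_pow z x : z ∈ pow x <-> z ⊆ x.
Proof.
unfold pow; rewrite mem_range; split.
- intros [Q ->] w Hw; apply mem_range in Hw; destruct Hw as [[i Hi] ->].
  apply mem_El; eauto.
- intros H; exists (fun i => elt i ∈ z); apply V_ext; intros w.
  rewrite mem_range; split.
  + intros Hw; destruct (proj1 (mem_El _ _) (H w Hw)) as [i ->].
    now exists (exist _ i Hw).
  + intros [[i Hi] ->]; exact Hi.
Qed.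

Definition inter (x y : V) : V := sep (fun z => z ∈ y) x.
Definition diff (x y : V) : V := sep (fun z => z ∉ y) x.
Notation "x ∩ y" := (inter x y) (at level 40, left associativity) : zf_scope.
Notation "x ∖ y" := (diff x y) (at level 40, left associativity) : zf_scope.

Definition empty : V := range (fun e : False => match e with end).
Notation "∅" := empty : zf_scope.

Lemma mem_empty x : x ∉ ∅.
Proof. unfold empty; rewrite mem_range; now intros [[] _]. Qed.

Definition succ (x : V) : V :=
  range (fun o : option (El x) => match o with Some i => elt i | None => x end).

Lemma mem_succ z x : z ∈ succ x <-> z ∈ x \/ z = x.
Proof.
unfold succ; rewrite mem_range, mem_El; split.
- intros [[i|] ->]; eauto.
- intros [[i ->]| ->]; [now exists (Some i)|now exists None].
Qed.

Definition omega : V := range (fun n : nat => Nat.iter n succ ∅).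

(* V_α is the union of the P(V_β) for β ∈ α. *)
Fixpoint rank_tree (t : tree) : V :=
  match t with
  | node A f =>
      range (fun p : {a : A & El (pow (rank_tree (f a)))} => elt (projT2 p))
  end.

Definition Vrank (alpha : V) : V := rank_tree (rep alpha).

Lemma mem_rank_tree z A (f : A -> tree) :
  z ∈ rank_tree (node A f) <-> exists a, z ⊆ rank_tree (f a).
Proof.
simpl; rewrite mem_range; split.
- intros [[a i] ->]; exists a; simpl; apply mem_pow, mem_El; eauto.
- intros [a Ha]; apply mem_pow, mem_El in Ha; destruct Ha as [i ->].
  now exists (existT _ a i).
Qed.

Lemma rank_tree_eqv s : forall t, eqv s t -> rank_tree s = rank_tree t.
Proof.
induction s as [A f IH]; intros [B g] [H1 H2]; apply V_ext; intros z.
rewrite !mem_rank_tree; split.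
- intros [a Ha]; destruct (H1 a) as [b Hb]; exists b; now rewrite <- (IH a _ Hb).
- intros [b Hb]; destruct (H2 b) as [a Ha]; exists a; now rewrite (IH a _ Ha).
Qed.

Lemma mem_Vrank z alpha : z ∈ Vrank alpha <-> exists beta, beta ∈ alpha /\ z ⊆ Vrank beta.
Proof.
unfold Vrank at 1; generalize (cls_rep alpha).
destruct (rep alpha) as [A f]; intros <-; rewrite mem_rank_tree; split.
- intros [a Ha]; exists (cls (f a)); split; [apply mem_cls; eauto|].
  unfold Vrank; now rewrite (rank_tree_eqv _ _ (rep_cls (f a))).
- intros [beta [Hb Hz]]; apply mem_cls in Hb; destruct Hb as [a ->]; exists a.
  unfold Vrank in Hz; now rewrite (rank_tree_eqv _ _ (rep_cls (f a))) in Hz.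
Qed.

Definition transitive (x : V) : Prop := forall y, y ∈ x -> y ⊆ x.

(* Von Neumann ordinals; well-foundedness of ∈ is V_ind. *)
Definition ordinal (alpha : V) : Prop :=
  transitive alpha /\ forall beta, beta ∈ alpha -> transitive beta.

Definition limit_ordinal (delta : V) : Prop :=
  ordinal delta /\ ∅ ∈ delta /\ forall alpha, alpha ∈ delta -> succ alpha ∈ delta.

Definition injects (x y : V) : Prop :=
  exists f : V -> V,
    (forall u, u ∈ x -> f u ∈ y) /\
    (forall u v, u ∈ x -> v ∈ x -> f u = f v -> u = v).

Definition card_lt (x y : V) : Prop := injects x y /\ ~ injects y x.

Definition cardinal (kappa : V) : Prop :=
  ordinal kappa /\ forall alpha, alpha ∈ kappa -> card_lt alpha kappa.

(* No map from a smaller ordinal into delta is cofinal. *)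
Definition regular (delta : V) : Prop :=
  forall (alpha : V) (g : V -> V), alpha ∈ delta ->
    (forall xi, xi ∈ alpha -> g xi ∈ delta) ->
    exists beta, beta ∈ delta /\ forall xi, xi ∈ alpha -> g xi ∈ beta.

Definition strong_limit (delta : V) : Prop :=
  forall alpha, alpha ∈ delta -> card_lt (pow alpha) delta.

Definition inaccessible (delta : V) : Prop :=
  cardinal delta /\ omega ∈ delta /\ regular delta /\ strong_limit delta.

(* In the following, "on X" means "on P(X)": the members of a filter are
   subsets of P(X). *)
Definition filter_on (X F : V) : Prop :=
  F ⊆ pow (pow X) /\
  pow X ∈ F /\
  (forall A B, A ∈ F -> B ∈ F -> A ∩ B ∈ F) /\
  (forall A B, A ∈ F -> A ⊆ B -> B ⊆ pow X -> B ∈ F) /\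
  ∅ ∉ F.

Definition fine (X F : V) : Prop :=
  forall x, x ∈ X -> sep (fun a => x ∈ a) (pow X) ∈ F.

Definition normal (X F : V) : Prop :=
  forall A : V -> V, (forall x, x ∈ X -> A x ∈ F) ->
    sep (fun a => forall x, x ∈ a -> a ∈ A x) (pow X) ∈ F.

Definition normal_filter (X F : V) : Prop :=
  filter_on X F /\ fine X F /\ normal X F.

Definition projection (Y G : V) : V :=
  image (fun A => image (fun a => a ∩ Y) A) G.

Definition projects_to (G Y H : V) : Prop := projection Y G = H.

(* Only the values of F on members of V_delta matter. *)
Definition tower (delta P : V) (F : V -> V) : Prop :=
  limit_ordinal delta /\
  (forall X, X ∈ Vrank delta -> normal_filter X (F X)) /\
  (forall X Y, X ∈ Vrank delta -> Y ∈ Vrank delta -> X ⊆ Y ->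
     projects_to (F Y) X (F X)) /\
  (forall S, S ∈ P <->
     S ∈ Vrank delta /\
     exists X, X ∈ Vrank delta /\ S ⊆ pow X /\ pow X ∖ S ∉ F X).

(* Finite sequences of elements of Z are lists all of whose entries lie in Z. *)
Definition over (Z : V) (s : list V) : Prop := Forall (fun x => x ∈ Z) s.

Definition club (Z C : V) : Prop :=
  exists f : list V -> V,
    (forall s, over Z s -> f s ∈ Z) /\
    C = sep (fun a => forall s, over a s -> f s ∈ a) (pow Z).

(* Supersets of finite intersections of clubs. *)
Definition club_filter (Z : V) : V :=
  sep (fun A => exists Cs : list V, Forall (club Z) Cs /\
         forall a, a ⊆ Z -> Forall (fun C => a ∈ C) Cs -> a ∈ A)
      (pow (pow Z)).

Definition stationary (Z S : V) : Prop :=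
  S ⊆ pow Z /\ forall C, club Z C -> exists a, a ∈ S /\ a ∈ C.

Definition restrict (Z G S : V) : V :=
  sep (fun B => exists A, A ∈ G /\ A ∩ S ⊆ B) (pow (pow Z)).

(* Main.v *)
(** The stationary set consists of the [a ⊆ V_δ] such that [a ∩ X ∈ A]
    whenever [X, A ∈ a] and [A ∈ F_X].  Almost every such [a] contains any
    given [X] and [A], which gives [F_X ⊆] the projection.  Conversely, given
    clubs of [P(V_δ)], inaccessibility yields a transitive [Y ∈ V_δ] that
    contains [X] and is closed under the functions generating them.  By
    normality [F_Y]-almost every [a ⊆ Y] is closed under these functions and
    belongs to the stationary set; projecting this set of measure one to [X]
    shows that the projection is contained in [F_X]. *)
From Stdlib Require Import List ClassicalEpsilon FunctionalExtensionality
  Arith Lia.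
Require Import Defs.

Lemma V_inhabited : inhabited V.
Proof. exact (inhabits empty). Qed.

Lemma choice_on {A : Type} (Q : A -> Prop) (R : A -> V -> Prop) :
  (forall x, Q x -> exists y, R x y) ->
  exists g : A -> V, forall x, Q x -> R x (g x).
Proof.
intros H; exists (fun x => epsilon V_inhabited (R x)).
intros x Hx; apply epsilon_spec; auto.
Qed.

(** * Ordinals and ranks *)

Lemma mem_wf : well_founded mem.
Proof. intros x; induction x as [x IH] using V_ind; constructor; exact IH. Qed.

Lemma mem_irrefl x : x ∉ x.
Proof. induction x as [x IH] using V_ind; intros H; exact (IH x H H). Qed.

Lemma ordinal_mem alpha beta : ordinal alpha -> beta ∈ alpha -> ordinal beta.
Proof.
intros [H1 H2] Hb; split; [now apply H2|].
intros gamma Hg; apply H2; now apply (H1 beta).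
Qed.

(** Double ∈-induction: if neither ordinal belongs to the other, every element of one is comparable
    with the other and can only belong to it, so the two agree by extensionality. *)
Lemma ordinal_trichotomy alpha : ordinal alpha -> forall beta, ordinal beta ->
  alpha ∈ beta \/ alpha = beta \/ beta ∈ alpha.
Proof.
induction alpha as [alpha IHa] using V_ind; intros Ha.
induction beta as [beta IHb] using V_ind; intros Hb.
destruct (classic (alpha ∈ beta)) as [|N1]; [auto|].
destruct (classic (beta ∈ alpha)) as [|N2]; [auto|].
right; left; apply V_ext; intros z; split; intros Hz.
- destruct (IHa z Hz (ordinal_mem _ _ Ha Hz) beta Hb) as [H|[->|H]]; auto.
  + contradiction.
  + destruct N2; apply (proj1 Ha z Hz); exact H.
- destruct (IHb z Hz (ordinal_mem _ _ Hb Hz)) as [H|[->|H]]; auto.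
  + destruct N1; apply (proj1 Hb z Hz); exact H.
  + contradiction.
Qed.

Lemma ordinal_directed delta alpha beta :
  ordinal delta -> alpha ∈ delta -> beta ∈ delta ->
  exists mu, mu ∈ delta /\ alpha ⊆ mu /\ beta ⊆ mu.
Proof.
intros Hd Ha Hb.
pose proof (ordinal_mem _ _ Hd Ha) as Oa; pose proof (ordinal_mem _ _ Hd Hb) as Ob.
destruct (ordinal_trichotomy alpha Oa beta Ob) as [H|[->|H]].
- exists beta; split; [|split]; auto; [exact (proj1 Ob _ H)|now intros z].
- exists beta; split; [|split]; auto; now intros z.
- exists alpha; split; [|split]; auto; [now intros z|exact (proj1 Oa _ H)].
Qed.

Lemma Vrank_mono alpha beta : alpha ⊆ beta -> Vrank alpha ⊆ Vrank beta.
Proof.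
intros H z; rewrite !mem_Vrank; intros [gamma [Hg Hz]]; exists gamma; auto.
Qed.

Lemma Vrank_transitive alpha : ordinal alpha -> transitive (Vrank alpha).
Proof.
intros Ha z Hz; apply mem_Vrank in Hz; destruct Hz as [beta [Hb Hz]].
intros w Hw; apply (Vrank_mono beta); auto; exact (proj1 Ha _ Hb).
Qed.

Definition num (n : nat) : V := Nat.iter n succ ∅.

Lemma num_omega n : num n ∈ omega.
Proof. apply mem_range; now exists n. Qed.

Lemma num_lt m n : m < n -> num m ∈ num n.
Proof.
induction 1; apply (proj2 (mem_succ _ _)); auto.
Qed.

Lemma num_inj m n : num m = num n -> m = n.
Proof.
intros E; destruct (lt_eq_lt_dec m n) as [[H|H]|H]; auto; exfalso;
  apply num_lt in H; rewrite E in H; now apply mem_irrefl in H.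
Qed.

(** Inverse of [num]; its value at a set that is not a numeral is unspecified. *)
Definition unnum (x : V) : nat := epsilon (inhabits 0) (fun n => x = num n).

Lemma numK n : unnum (num n) = n.
Proof.
apply num_inj; symmetry; unfold unnum.
now apply (epsilon_spec (inhabits 0) (fun k => num n = num k)); exists n.
Qed.

Lemma num_sub_Vrank n : num n ⊆ Vrank (num n).
Proof.
induction n as [|n IH]; intros z Hz; [now apply mem_empty in Hz|].
apply mem_succ in Hz; destruct Hz as [Hz| ->].
- apply (Vrank_mono (num n)); auto; intros w Hw; apply mem_succ; auto.
- apply mem_Vrank; exists (num n); split; auto; apply mem_succ; auto.
Qed.

Lemma num_Vrank n alpha : omega ⊆ alpha -> num n ∈ Vrank alpha.
Proof.
intros H; apply mem_Vrank; exists (num n); split; [apply H, num_omega|].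
apply num_sub_Vrank.
Qed.

(** * Boundedness below an inaccessible *)

Lemma injects_trans x y z : injects x y -> injects y z -> injects x z.
Proof.
intros [f [f1 f2]] [g [g1 g2]]; exists (fun u => g (f u)); split; auto.
Qed.

Lemma injects_sub x y : x ⊆ y -> injects x y.
Proof. intros H; exists (fun u => u); auto. Qed.

Lemma injects_pow x y : injects x y -> injects (pow x) (pow y).
Proof.
intros [f [f1 f2]]; exists (image f); split.
- intros u Hu; apply mem_pow in Hu; apply mem_pow; intros z Hz.
  apply mem_image in Hz; destruct Hz as [w [Hw ->]]; auto.
- assert (K : forall u v, u ⊆ x -> v ⊆ x -> image f u = image f v -> u ⊆ v).
  { intros u v Hu Hv E z Hz.
    assert (Hi : f z ∈ image f v) by (rewrite <- E; apply mem_image; eauto).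
    apply mem_image in Hi; destruct Hi as [w [Hw Ew]].
    now rewrite (f2 z w) by auto. }
  intros u v Hu Hv E; apply mem_pow in Hu; apply mem_pow in Hv.
  apply V_ext; intros z; split; apply K; auto.
Qed.

Definition upair (x y : V) : V := range (fun b : bool => if b then x else y).

Lemma mem_upair z x y : z ∈ upair x y <-> z = x \/ z = y.
Proof.
unfold upair; rewrite mem_range; split.
- intros [[|] ->]; auto.
- intros [->| ->]; [now exists true|now exists false].
Qed.

Lemma upair_inj_r x y z : upair x y = upair x z -> y = z.
Proof.
intros E.
assert (Hy : y ∈ upair x z) by (rewrite <- E; apply mem_upair; auto).
assert (Hz : z ∈ upair x y) by (rewrite E; apply mem_upair; auto).
apply mem_upair in Hy; apply mem_upair in Hz.
destruct Hy as [Hy|Hy], Hz as [Hz|Hz]; congruence.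
Qed.

(** The Kuratowski pair; [small_Vrank] uses it to tag a set with a bound on its rank. *)
Definition kpair (x y : V) : V := upair (upair x x) (upair x y).

Lemma kpair_inj x y x' y' : kpair x y = kpair x' y' -> x = x' /\ y = y'.
Proof.
intros E.
assert (Ex : x = x').
{ assert (H : upair x x ∈ kpair x' y') by (rewrite <- E; apply mem_upair; auto).
  assert (H' : x' ∈ upair x x).
  { apply mem_upair in H; destruct H as [-> | ->]; apply mem_upair; auto. }
  apply mem_upair in H'; destruct H'; auto. }
subst x'; split; auto.
now apply upair_inj_r in E; apply upair_inj_r in E.
Qed.

Lemma kpair_pow x y z : x ∈ z -> y ∈ z -> kpair x y ∈ pow (pow z).
Proof.
intros Hx Hy; apply mem_pow; intros u Hu; apply mem_upair in Hu; apply mem_pow.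
intros w Hw; destruct Hu as [-> | ->]; apply mem_upair in Hw; destruct Hw as [-> | ->]; auto.
Qed.

(** Regularity of [delta] with an arbitrary set [W] as index set in place of an ordinal. *)
Definition bounding (delta W : V) : Prop :=
  forall h : V -> V, (forall w, w ∈ W -> h w ∈ delta) ->
    exists beta, beta ∈ delta /\ forall w, w ∈ W -> h w ∈ beta.

(* An unbounded map on W would let us enumerate, by recursion on delta,
   points of W with pairwise distinct values. *)
Lemma not_injects_bounding delta W :
  ordinal delta -> regular delta -> ~ injects delta W -> bounding delta W.
Proof.
intros Od Rd NI h Hh; apply NNPP; intros NB; apply NI.
pose (step := fun (xi : V) (rec : forall eta, eta ∈ xi -> V) =>
  epsilon V_inhabited
    (fun w => w ∈ W /\ forall eta (H : eta ∈ xi), h w <> h (rec eta H))).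
pose (e := Fix mem_wf (fun _ => V) step).
assert (Ee : forall xi, e xi = epsilon V_inhabited
    (fun w => w ∈ W /\ forall eta, eta ∈ xi -> h w <> h (e eta))).
{ intros xi; unfold e at 1; rewrite Fix_eq; [reflexivity|].
  intros x f g Hfg; f_equal; extensionality y; extensionality p; apply Hfg. }
assert (K : forall xi, xi ∈ delta ->
    e xi ∈ W /\ forall eta, eta ∈ xi -> h (e xi) <> h (e eta)).
{ induction xi as [xi IH] using V_ind; intros Hxi.
  assert (Hsub : xi ⊆ delta) by exact (proj1 Od _ Hxi).
  (* Regularity bounds the values at earlier stages. Were there no fresh point, every value on [W]
     would be one of these, and the same bound would serve all of [W]. *)
  destruct (Rd xi (fun eta => h (e eta)) Hxi) as [beta [Hb Hbb]].
  { intros eta He; apply Hh, IH; auto. }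
  rewrite Ee; apply epsilon_spec; apply NNPP; intros N; apply NB.
  exists beta; split; auto; intros w Hw; apply NNPP; intros Hnb; apply N.
  exists w; split; auto; intros eta He E; apply Hnb; rewrite E; auto. }
exists e; split; [apply K|].
intros u v Hu Hv E.
destruct (ordinal_trichotomy u (ordinal_mem _ _ Od Hu) v (ordinal_mem _ _ Od Hv))
  as [H|[H|H]]; auto; exfalso.
- now apply (proj2 (K v Hv) u H); rewrite E.
- now apply (proj2 (K u Hu) v H); rewrite E.
Qed.

Definition small (delta x : V) : Prop := exists alpha, alpha ∈ delta /\ injects x alpha.

Lemma small_injects delta x y : injects x y -> small delta y -> small delta x.
Proof.
intros I [alpha [Ha J]]; exists alpha; split; eauto using injects_trans.
Qed.

Lemma small_bounding delta x : cardinal delta -> regular delta ->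
  small delta x -> bounding delta x.
Proof.
intros [Od Cd] Rd [alpha [Ha I]]; apply not_injects_bounding; auto.
intros J; apply (Cd alpha Ha); eauto using injects_trans.
Qed.

(** The strong limit property injects [pow alpha] into [delta] and forbids an injection back. Hence
    the values of that injection are bounded by some [beta] in [delta], and it is an injection into
    [beta]. *)
Lemma small_pow delta x : inaccessible delta -> small delta x -> small delta (pow x).
Proof.
intros [[Od Cd] [_ [Rd Sd]]] [alpha [Ha I]].
apply small_injects with (pow alpha); [now apply injects_pow|].
destruct (Sd alpha Ha) as [[j [j1 j2]] N].
destruct (not_injects_bounding delta (pow alpha) Od Rd N j j1) as [beta [Hb Hj]].
exists beta; split; auto; exists j; auto.
Qed.

(** By induction, each [pow (Vrank gamma)] with [gamma] in [alpha] injects into some [m gamma] in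
    [delta]. Coding [z] by a [gamma] with [z ⊆ Vrank gamma] and its image in [m gamma] injects
    [Vrank alpha] into pairs over one ordinal [nu] of [delta]. *)
Lemma small_Vrank delta alpha : inaccessible delta -> alpha ∈ delta ->
  small delta (Vrank alpha).
Proof.
intros Id; pose proof Id as [[Od Cd] [_ [Rd Sd]]].
induction alpha as [alpha IH] using V_ind; intros Ha.
assert (Hsub : alpha ⊆ delta) by exact (proj1 Od _ Ha).
destruct (choice_on (fun gamma => gamma ∈ alpha)
  (fun gamma mu => mu ∈ delta /\ injects (pow (Vrank gamma)) mu)) as [m Hm].
{ intros gamma Hg; apply small_pow; auto. }
destruct (Rd alpha m Ha) as [mu [Hmu Hmm]]; [intros xi Hxi; now apply Hm|].
destruct (ordinal_directed delta alpha mu Od Ha Hmu) as [nu [Hnu [S1 S2]]].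
assert (Omu := ordinal_mem _ _ Od Hmu).
apply small_injects with (pow (pow nu)).
2: { apply small_pow; auto; apply small_pow; auto; exists nu; split; auto; apply injects_sub; now intros z. }
(* One injection is fixed for each [gamma], so that equal codes are compared under the same map. *)
pose (J := fun gamma (j : V -> V) =>
  (forall u, u ∈ pow (Vrank gamma) -> j u ∈ m gamma) /\
  (forall u v, u ∈ pow (Vrank gamma) -> v ∈ pow (Vrank gamma) -> j u = j v -> u = v)).
pose (j := fun gamma => epsilon (inhabits (fun x : V => x)) (J gamma)).
assert (Hj : forall gamma, gamma ∈ alpha -> J gamma (j gamma)).
{ intros gamma Hg; apply epsilon_spec; exact (proj2 (Hm gamma Hg)). }
destruct (choice_on (fun z => z ∈ Vrank alpha)
  (fun z gamma => gamma ∈ alpha /\ z ⊆ Vrank gamma)) as [r Hr].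
{ intros z Hz; now apply mem_Vrank. }
exists (fun z => kpair (r z) (j (r z) z)); split.
- intros z Hz; destruct (Hr z Hz) as [R1 R2]; apply kpair_pow; auto.
  apply S2, (proj1 Omu (m (r z))); auto.
  apply (Hj (r z) R1); now apply mem_pow.
- intros u v Hu Hv E; apply kpair_inj in E; destruct E as [E1 E2].
  destruct (Hr u Hu) as [R1 R2]; destruct (Hr v Hv) as [R3 R4].
  rewrite <- E1 in *; apply (Hj (r u) R1); auto; now apply mem_pow.
Qed.

Lemma Vrank_bounding delta alpha : inaccessible delta -> alpha ∈ delta ->
  bounding delta (Vrank alpha).
Proof.
intros Id Ha; pose proof Id as [Cd [_ [Rd _]]].
apply small_bounding; auto; now apply small_Vrank.
Qed.

Lemma nat_bounded delta (h : nat -> V) : inaccessible delta ->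
  (forall n, h n ∈ delta) -> exists beta, beta ∈ delta /\ forall n, h n ∈ beta.
Proof.
intros [_ [Wd [Rd _]]] Hh.
destruct (Rd omega (fun x => h (unnum x)) Wd) as [beta [Hb K]]; auto.
exists beta; split; auto; intros n; rewrite <- (numK n); apply K, num_omega.
Qed.

(** Induction on the length: the bounds obtained for the tails after each first entry [x] are
    themselves bounded, since [W] is bounding. *)
Lemma length_lists_bounded delta W n : limit_ordinal delta -> bounding delta W ->
  forall h : list V -> V, (forall s, over W s -> h s ∈ delta) ->
  exists beta, beta ∈ delta /\ forall s, over W s -> length s = n -> h s ∈ beta.
Proof.
intros [Od [_ Ld]] HW; induction n as [|n IH]; intros h Hh.
- exists (succ (h nil)); split; [apply Ld, Hh; constructor|].
  intros [|] _ E; [apply mem_succ; auto|discriminate].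
- destruct (choice_on (fun x => x ∈ W) (fun x beta => beta ∈ delta /\
    forall s, over W s -> length s = n -> h (x :: s) ∈ beta)) as [b Hb].
  { intros x Hx; apply IH; intros s Hs; apply Hh; now constructor. }
  destruct (HW b) as [beta [Hbeta K]]; [intros; now apply Hb|].
  exists beta; split; auto; intros [|x s] Hs E; [discriminate|].
  inversion Hs; subst; injection E as E.
  apply (proj1 (ordinal_mem _ _ Od Hbeta) (b x)); auto; now apply Hb.
Qed.

(** Two countable suprema, first over the lengths of lists and then over [k]. *)
Lemma lists_bounded delta W (h : nat -> list V -> V) :
  inaccessible delta -> limit_ordinal delta -> bounding delta W ->
  (forall k s, over W s -> h k s ∈ delta) ->
  exists beta, beta ∈ delta /\ forall k s, over W s -> h k s ∈ beta.
Proof.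
intros Id Ld HW Hh.
assert (K : forall k, True -> exists beta, beta ∈ delta /\
  forall s, over W s -> h k s ∈ beta).
{ intros k _.
  destruct (choice_on (fun _ : nat => True) (fun n beta => beta ∈ delta /\
    forall s, over W s -> length s = n -> h k s ∈ beta)) as [b Hb].
  { intros n _; apply length_lists_bounded; auto. }
  destruct (nat_bounded delta b Id) as [beta [Hbeta Hbb]]; [intros n; now apply Hb|].
  exists beta; split; auto; intros s Hs.
  apply (proj1 (ordinal_mem _ _ (proj1 Ld) Hbeta) (b (length s))); auto.
  now apply Hb. }
apply choice_on in K; destruct K as [b Hb].
destruct (nat_bounded delta b Id) as [beta [Hbeta Hbb]]; [intros n; now apply Hb|].
exists beta; split; auto; intros k s Hs.
apply (proj1 (ordinal_mem _ _ (proj1 Ld) Hbeta) (b k)); auto; now apply Hb.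
Qed.

(** * Closing off under countably many finitary functions *)

Definition closed_under (f : nat -> list V -> V) (a : V) : Prop :=
  forall k s, over a s -> f k s ∈ a.

Lemma closed_rank_step delta (f : nat -> list V -> V) alpha :
  inaccessible delta -> limit_ordinal delta ->
  (forall k s, over (Vrank delta) s -> f k s ∈ Vrank delta) -> alpha ∈ delta ->
  exists beta, beta ∈ delta /\ alpha ⊆ beta /\
    forall k s, over (Vrank alpha) s -> f k s ∈ Vrank beta.
Proof.
intros Id Ld Hf Ha.
destruct (choice_on (fun z => z ∈ Vrank delta)
  (fun z gamma => gamma ∈ delta /\ z ⊆ Vrank gamma)) as [r Hr].
{ intros z Hz; now apply mem_Vrank. }
assert (Hover : forall s, over (Vrank alpha) s -> over (Vrank delta) s).
{ intros s; apply Forall_impl; intros x; apply Vrank_mono; exact (proj1 (proj1 Ld) _ Ha). }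
destruct (lists_bounded delta (Vrank alpha) (fun k s => r (f k s))) as [gamma [Hg K]]; auto.
{ now apply Vrank_bounding. }
{ intros k s Hs; apply Hr; auto. }
destruct (ordinal_directed delta alpha gamma (proj1 Ld) Ha Hg) as [beta [Hb [S1 S2]]].
exists beta; split; [|split]; auto; intros k s Hs.
apply mem_Vrank; exists (r (f k s)); split; auto; apply Hr; auto.
Qed.

(** [Y] is the union of the [Vrank (b n)], where the ordinals [b n] arise by iterating
    [closed_rank_step]; regularity bounds them below [delta]. *)
Lemma ex_closed_transitive delta (f : nat -> list V -> V) X :
  inaccessible delta -> limit_ordinal delta ->
  (forall k s, over (Vrank delta) s -> f k s ∈ Vrank delta) -> X ∈ Vrank delta ->
  exists Y, Y ∈ Vrank delta /\ X ⊆ Y /\ transitive Y /\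
    (forall n, num n ∈ Y) /\ closed_under f Y.
Proof.
intros Id Ld Hf HX; pose proof Id as [_ [Wd _]]; pose proof Ld as [Od _].
apply mem_Vrank in HX; destruct HX as [alpha [Ha HX]].
(* Starting above [omega] puts all numerals into [Y]. *)
destruct (ordinal_directed delta alpha omega Od Ha Wd) as [b0 [Hb0 [S1 S2]]].
destruct (choice_on (fun alpha => alpha ∈ delta) (fun alpha beta =>
  beta ∈ delta /\ alpha ⊆ beta /\
  forall k s, over (Vrank alpha) s -> f k s ∈ Vrank beta)) as [g Hg].
{ intros; now apply closed_rank_step. }
pose (b := fun n => Nat.iter n g b0).
assert (Hb : forall n, b n ∈ delta) by (induction n; [|apply Hg]; auto).
assert (Hmono : forall m n, m <= n -> b m ⊆ b n).
{ induction 1 as [|n _ IH]; [now intros z|].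
  intros z Hz; apply (proj2 (Hg (b n) (Hb n))); auto. }
destruct (nat_bounded delta b Id Hb) as [beta [Hbeta K]].
(* The union is carved out of [Vrank beta], which makes it a member of [Vrank delta]. *)
exists (sep (fun z => exists n, z ∈ Vrank (b n)) (Vrank beta)).
assert (M : forall z, z ∈ sep (fun z => exists n, z ∈ Vrank (b n)) (Vrank beta) <->
  exists n, z ∈ Vrank (b n)).
{ intros z; rewrite mem_sep; split; [tauto|]; intros [n Hn]; split; eauto.
  apply (Vrank_mono (b n)); auto.
  exact (proj1 (ordinal_mem _ _ Od Hbeta) _ (K n)). }
split; [|split; [|split; [|split]]].
- apply mem_Vrank; exists beta; split; auto; intros z Hz; now apply mem_sep in Hz.
- intros z Hz; apply M; exists 0; apply (Vrank_mono alpha); auto.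
- intros y Hy z Hz; apply M in Hy; destruct Hy as [n Hn]; apply M; exists n.
  exact (Vrank_transitive _ (ordinal_mem _ _ Od (Hb n)) y Hn z Hz).
- intros n; apply M; exists 0; now apply num_Vrank.
- intros k s Hs; apply M.
  (* A finite list from the union already lies in one stage, so its value lies in the next. *)
  assert (Hn : exists n, over (Vrank (b n)) s).
  { induction s as [|x s IH]; [exists 0; constructor|].
    inversion Hs as [|? ? Hx Hs']; subst.
    destruct (IH Hs') as [n Hn]; apply M in Hx; destruct Hx as [m Hm].
    exists (Nat.max m n); constructor.
    - apply (Vrank_mono (b m)); auto; apply Hmono; lia.
    - revert Hn; apply Forall_impl; intros y; apply Vrank_mono, Hmono; lia. }
  destruct Hn as [n Hn]; exists (S n); now apply (Hg (b n)).
Qed.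

(** * Normal filters *)

(** The measure quantifier of the filter [G], which allows reasoning with predicates instead of
    members of [G]. *)
Definition almost_all (Y G : V) (Q : V -> Prop) : Prop := sep Q (pow Y) ∈ G.

Section NormalFilter.

Context (Y G : V) (HG : normal_filter Y G).

Lemma almost_all_sub A (Q : V -> Prop) : A ∈ G ->
  (forall a, a ∈ A -> a ⊆ Y -> Q a) -> almost_all Y G Q.
Proof.
intros HA HQ; destruct HG as [[H1 [_ [_ [H4 _]]]] _].
apply H4 with A; auto; intros a Ha.
- assert (K : a ∈ pow Y) by exact (proj1 (mem_pow _ _) (H1 A HA) a Ha).
  apply mem_sep; split; auto; apply HQ; auto; now apply mem_pow.
- now apply mem_sep in Ha.
Qed.

Lemma almost_all_impl (Q R : V -> Prop) : almost_all Y G Q ->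
  (forall a, a ⊆ Y -> Q a -> R a) -> almost_all Y G R.
Proof.
intros HQ HR; apply almost_all_sub with (1 := HQ).
intros a Ha; apply mem_sep in Ha; intros; now apply HR.
Qed.

Lemma almost_all_and (Q R : V -> Prop) : almost_all Y G Q -> almost_all Y G R ->
  almost_all Y G (fun a => Q a /\ R a).
Proof.
intros HQ HR; pose proof HG as [[_ [_ [H3 _]]] _].
apply almost_all_sub with (1 := H3 _ _ HQ HR); intros a Ha _.
apply mem_sep in Ha; destruct Ha as [Ha1 Ha2].
apply mem_sep in Ha1; apply mem_sep in Ha2; tauto.
Qed.

Lemma almost_all_true (Q : V -> Prop) : (forall a, a ⊆ Y -> Q a) -> almost_all Y G Q.
Proof.
intros HQ; pose proof HG as [[_ [H2 _]] _].
apply almost_all_sub with (1 := H2); auto.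
Qed.

Lemma almost_all_fine y : y ∈ Y -> almost_all Y G (fun a => y ∈ a).
Proof. apply HG. Qed.

(** Normality as a quantifier rule: [almost_all] may be moved inside a quantifier over the elements
    of [a] itself. *)
Lemma almost_all_diag (Q : V -> V -> Prop) :
  (forall x, x ∈ Y -> almost_all Y G (Q x)) ->
  almost_all Y G (fun a => forall x, x ∈ a -> Q x a).
Proof.
intros HQ; pose proof HG as [_ [_ N]].
apply almost_all_sub with (1 := N (fun x => sep (Q x) (pow Y)) HQ).
intros a Ha _ x Hx; apply mem_sep in Ha.
apply (proj2 (proj1 (mem_sep _ _ _) (proj2 Ha x Hx))).
Qed.

(* Almost every [a] contains [num 0] and is closed under [num n ↦ num (S n)],
   hence contains all numerals; so diagonal intersections indexed by numerals
   are full intersections. *)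
Lemma almost_all_countable (Q : nat -> V -> Prop) : (forall n, num n ∈ Y) ->
  (forall n, almost_all Y G (Q n)) -> almost_all Y G (fun a => forall n, Q n a).
Proof.
intros HY HQ.
assert (H0 := almost_all_fine _ (HY 0)).
assert (HS : almost_all Y G (fun a => forall x, x ∈ a -> num (S (unnum x)) ∈ a)).
{ apply almost_all_diag; intros; now apply almost_all_fine. }
assert (HD : almost_all Y G (fun a => forall x, x ∈ a -> Q (unnum x) a)).
{ apply almost_all_diag; auto. }
apply almost_all_impl with (1 := almost_all_and _ _ H0 (almost_all_and _ _ HS HD)).
intros a _ [K0 [KS KD]] n; rewrite <- (numK n); apply KD.
induction n as [|n IH]; auto; rewrite <- (numK n); now apply KS.
Qed.

(** Induction on the length: fineness handles the value at [nil], and a diagonal intersection over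
    the first entry handles longer lists. *)
Lemma almost_all_closed_length n (f : list V -> V) :
  (forall s, over Y s -> f s ∈ Y) ->
  almost_all Y G (fun a => forall s, over a s -> length s = n -> f s ∈ a).
Proof.
revert f; induction n as [|n IH]; intros f Hf.
- apply almost_all_impl with (1 := almost_all_fine (f nil) (Hf nil (Forall_nil _))).
  intros a _ Ha [|] _ E; [auto|discriminate].
- apply almost_all_impl with (fun a => forall x, x ∈ a ->
    forall s, over a s -> length s = n -> f (x :: s) ∈ a).
  + apply almost_all_diag; intros x Hx; apply (IH (fun s => f (x :: s))).
    intros s Hs; apply Hf; now constructor.
  + intros a _ Ha [|x s] Hs E; [discriminate|].
    inversion Hs; subst; apply Ha; auto.
Qed.

Lemma almost_all_closed (f : nat -> list V -> V) : (forall n, num n ∈ Y) ->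
  closed_under f Y -> almost_all Y G (closed_under f).
Proof.
intros HY Hf; apply almost_all_countable; auto; intros k.
apply almost_all_impl with (fun a => forall n s, over a s -> length s = n -> f k s ∈ a).
- apply almost_all_countable; auto; intros n; apply almost_all_closed_length; auto.
- intros a _ Ha s Hs; now apply (Ha (length s)).
Qed.

End NormalFilter.

(** * Clubs *)

(** Merges the generating functions of finitely many clubs into one sequence, so that closure under
    a single family handles them all. *)
Lemma clubs_closed_under Z Cs : ∅ ∈ Z -> Forall (club Z) Cs ->
  exists f : nat -> list V -> V,
    (forall k s, over Z s -> f k s ∈ Z) /\
    forall a, a ⊆ Z -> closed_under f a -> Forall (fun C => a ∈ C) Cs.
Proof.
intros H0; induction 1 as [|C Cs [g [Hg ->]] _ [f [Hf K]]].
(* The constant [∅] pads the sequence after the last club. *)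
- exists (fun _ _ => ∅); split; auto.
- exists (fun k => match k with 0 => g | S k => f k end); split.
  + intros [|k]; auto.
  + intros a Ha Hc; constructor.
    * apply mem_sep; split; [now apply mem_pow|exact (Hc 0)].
    * apply K; auto; intros k; exact (Hc (S k)).
Qed.

Lemma club_const Z z : z ∈ Z -> club Z (sep (fun a => z ∈ a) (pow Z)).
Proof.
intros Hz; exists (fun _ => z); split; auto.
apply V_ext; intros a; rewrite !mem_sep; split; intros [H1 H2]; split; auto.
(* The empty list lies over every [a], so closure under the constant function forces [z] into
   [a]. *)
apply (H2 nil); constructor.
Qed.

Lemma mem_projection Y G D :
  D ∈ projection Y G <-> exists B, B ∈ G /\ D = image (fun a => a ∩ Y) B.
Proof. apply mem_image. Qed.

(** * The stationary set and its projections *)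

Definition tower_set (delta : V) (F : V -> V) : V :=
  sep (fun a => forall X, X ∈ a -> forall A, A ∈ a -> A ∈ F X -> a ∩ X ∈ A)
    (pow (Vrank delta)).

Section Tower.

Context (delta P : V) (F : V -> V).
Context (hdelta : inaccessible delta) (hP : tower delta P F).

Lemma almost_all_tower_set Y : Y ∈ Vrank delta -> transitive Y ->
  almost_all Y (F Y) (fun a => a ∈ tower_set delta F).
Proof.
intros HY TY; destruct hP as [[Od _] [HN [Hpr _]]].
assert (NY := HN Y HY).
assert (SY : Y ⊆ Vrank delta) by exact (Vrank_transitive _ Od Y HY).
apply (almost_all_impl _ _ NY)
  with (fun a => forall X, X ∈ a -> forall A, A ∈ a -> A ∈ F X -> a ∩ X ∈ A).
- apply almost_all_diag; auto; intros X HX; apply almost_all_diag; auto; intros A HA.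
  destruct (classic (A ∈ F X)) as [HF|HF].
  (* Transitivity of [Y] gives [X ⊆ Y], so [A] is the projection of some [B] in [F Y], and every [a]
     in [B] has its trace on [X] in [A]. *)
  + rewrite <- (Hpr X Y) in HF; auto.
    apply mem_projection in HF; destruct HF as [B [HB ->]].
    apply (almost_all_sub _ _ NY B); auto; intros a Ha _ _.
    apply mem_image; eauto.
  + apply (almost_all_true _ _ NY); intros; contradiction.
- intros a Ha K; apply mem_sep; split; auto.
  apply mem_pow; intros z Hz; auto.
Qed.

(** Serves both stationarity, with [X] empty, and the inclusion of the projection in [F X]. [D] is
    the projection to [X] of the set of closed [a ⊆ Y] in [tower_set], which belongs to [F Y]. *)
Lemma tower_set_trace (f : nat -> list V -> V) X :
  (forall k s, over (Vrank delta) s -> f k s ∈ Vrank delta) -> X ∈ Vrank delta ->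
  exists D, D ∈ F X /\ forall d, d ∈ D ->
    exists a, a ∈ tower_set delta F /\ closed_under f a /\ d = a ∩ X.
Proof.
intros Hf HX; pose proof hP as [Ld [HN [Hpr _]]].
destruct (ex_closed_transitive delta f X) as [Y [HY [SXY [TY [NumY CY]]]]]; auto.
assert (NY := HN Y HY).
pose proof (almost_all_and _ _ NY _ _ (almost_all_tower_set Y HY TY)
  (almost_all_closed _ _ NY f NumY CY)) as K.
eexists; split.
- rewrite <- (Hpr X Y) by auto; apply mem_projection; eexists; split; [exact K|reflexivity].
- intros d Hd; apply mem_image in Hd; destruct Hd as [a [Ha ->]].
  apply mem_sep in Ha; exists a; tauto.
Qed.

(** Subsets of [X] have rank at most that of [X], so one successor step suffices. Thus [A] can
    itself be an element of some [a ⊆ Vrank delta], as the definition of [tower_set] exploits. *)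
Lemma filter_mem_Vrank X A : X ∈ Vrank delta -> A ∈ F X -> A ∈ Vrank delta.
Proof.
intros HX HA; pose proof hP as [[_ [_ Ld]] [HN _]].
pose proof (HN X HX) as [[H1 _] _].
assert (SA : A ⊆ pow X) by now apply mem_pow, H1.
apply mem_Vrank in HX; destruct HX as [beta [Hb HX]].
apply mem_Vrank; exists (succ beta); split; auto.
intros a Ha; apply SA, mem_pow in Ha; apply mem_Vrank; exists beta.
split; [apply mem_succ; auto|]; intros z Hz; auto.
Qed.

Lemma empty_mem_Vrank : ∅ ∈ Vrank delta.
Proof.
destruct hP as [[_ [H0 _]] _]; apply mem_Vrank; exists ∅; split; auto.
intros z Hz; now apply mem_empty in Hz.
Qed.

Lemma stationary_tower_set : stationary (Vrank delta) (tower_set delta F).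
Proof.
split; [intros a Ha; now apply mem_sep in Ha|].
intros C HC.
destruct (clubs_closed_under (Vrank delta) (C :: nil)) as [f [Hf K]];
  [exact empty_mem_Vrank|now constructor|].
(* Any element of [D] yields a point of [tower_set] in [C], and [D] is nonempty because [∅] is not
   in [F ∅]. *)
destruct (tower_set_trace f ∅ Hf empty_mem_Vrank) as [D [HD KD]].
pose proof hP as [_ [HN _]].
pose proof (HN ∅ empty_mem_Vrank) as [[_ [_ [_ [_ NE]]]] _].
destruct (classic (exists d, d ∈ D)) as [[d Hd]|N].
- destruct (KD d Hd) as [a [Ha [Hc _]]]; exists a; split; auto.
  apply mem_sep in Ha; destruct Ha as [Ha _]; apply mem_pow in Ha.
  specialize (K a Ha Hc); now inversion K.
- destruct NE; replace ∅ with D at 1; auto; apply V_ext; intros z; split; intros Hz.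
  + destruct N; eauto.
  + now apply mem_empty in Hz.
Qed.

Lemma restrict_projects X : X ∈ Vrank delta ->
  projects_to (restrict (Vrank delta) (club_filter (Vrank delta)) (tower_set delta F))
    X (F X).
Proof.
intros HX; pose proof hP as [[Od _] [HN _]].
pose proof (HN X HX) as [[H1 [_ [_ [H4 _]]]] _].
apply V_ext; intros D; rewrite mem_projection; split.
- intros [B [HB ->]]; apply mem_sep in HB; destruct HB as [HB [A [HA AB]]].
  apply mem_sep in HA; destruct HA as [_ [Cs [HCs HA]]].
  destruct (clubs_closed_under (Vrank delta) Cs) as [f [Hf K]]; auto using empty_mem_Vrank.
  (* [E] consists of traces of points of [tower_set] lying in all of [Cs], hence in [B]; so the
     projection of [B] includes [E]. *)
  destruct (tower_set_trace f X Hf HX) as [E [HE KE]].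
  apply H4 with E; auto.
  + intros d Hd; destruct (KE d Hd) as [a [Ha [Hc ->]]].
    apply mem_image; exists a; split; auto; apply AB, mem_sep; split; auto.
    apply mem_sep in Ha; destruct Ha as [Ha _]; apply mem_pow in Ha; auto.
  + intros d Hd; apply mem_image in Hd; destruct Hd as [a [_ ->]].
    apply mem_pow; intros z Hz; now apply mem_sep in Hz.
- intros HD.
  assert (SD : D ⊆ pow X) by now apply mem_pow, H1.
  assert (HDV := filter_mem_Vrank X D HX HD).
  (* The full preimage of [D]: it contains every point of [tower_set] having both [X] and [D] as
     elements, a condition given by two clubs. *)
  exists (sep (fun a => a ∩ X ∈ D) (pow (Vrank delta))); split.
  + apply mem_sep; split.
    { apply mem_pow; intros a Ha; now apply mem_sep in Ha. }
    exists (sep (fun a => X ∈ a /\ D ∈ a) (pow (Vrank delta))); split.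
    * apply mem_sep; split.
      { apply mem_pow; intros a Ha; now apply mem_sep in Ha. }
      exists (sep (fun a => X ∈ a) (pow (Vrank delta)) ::
              sep (fun a => D ∈ a) (pow (Vrank delta)) :: nil); split.
      { repeat constructor; now apply club_const. }
      intros a Ha K; inversion K as [|? ? K1 K']; subst.
      inversion K' as [|? ? K2 _]; subst.
      apply mem_sep in K1; apply mem_sep in K2; apply mem_sep; tauto.
    * intros a Ha; apply mem_sep in Ha; destruct Ha as [Ha Hs].
      apply mem_sep in Ha; apply mem_sep in Hs; apply mem_sep; split; [tauto|].
      now apply Hs.
  + apply V_ext; intros d; rewrite mem_image; split.
    (* As [d ⊆ X], it is its own trace, so every element of [D] is attained. *)
    * intros Hd; exists d.
      assert (Ed : d ∩ X = d).
      { apply V_ext; intros z; unfold inter; rewrite mem_sep; split; [tauto|].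
        intros Hz; split; auto; exact (proj1 (mem_pow _ _) (SD d Hd) z Hz). }
      split; auto; apply mem_sep; rewrite Ed; split; auto.
      apply mem_pow; intros z Hz; apply (Vrank_transitive _ Od X HX).
      exact (proj1 (mem_pow _ _) (SD d Hd) z Hz).
    * intros [a [Ha ->]]; now apply mem_sep in Ha.
Qed.

End Tower.

Theorem theorem3p3 (delta P : V) (F : V -> V)
  (hdelta : inaccessible delta) (hP : tower delta P F) :
  exists S : V, stationary (Vrank delta) S /\
    forall X, X ∈ Vrank delta ->
      projects_to (restrict (Vrank delta) (club_filter (Vrank delta)) S) X (F X).
Proof.
exists (tower_set delta F); split.
- exact (stationary_tower_set delta P F hdelta hP).
- exact (restrict_projects delta P F hdelta hP).
Qed.
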